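(* If $(L,\alpha_L)$ is a perfect Hom-Lie algebra, then the central extension $\psi:(L\star L,\alpha_{L\star L})\twoheadrightarrow(L,\alpha_L)$, $\psi(l\star l')=[l,l']$, is the universal central extension of $(L,\alpha_L)$.
   Context: All vector spaces, linear maps and tensor products are over a fixed field $\mathbb{K}$. A Hom-Lie algebra $(L,\alpha_L)$ is a vector space $L$ with a bilinear product $[-,-]$ and a linear map $\alpha_L:L\to L$ such that $[x,y]=-[y,x]$, $[\alpha_L(x),[y,z]]+[\alpha_L(z),[x,y]]+[\alpha_L(y),[z,x]]=0$ and (multiplicativity, always assumed) $\alpha_L[x,y]=[\alpha_L(x),\alpha_L(y)]$ for all $x,y,z\in L$. Homomorphisms are linear maps preserving products and commuting with the endomorphisms $\alpha$. $(L,\alpha_L)$ is perfect if $L=[L,L]$, where $[L,L]$ is the span of all $[x,y]$, $x,y\in L$. The non-abelian tensor product $(L\star L,\alpha_{L\star L})$, where $L$ acts on itself by its product (${}^xy=[x,y]$), is the quotient of $L\otimes L$ by the subspace generated by all elements (a) $[m,m']\otimes\alpha_L(n)-\alpha_L(m)\otimes[m',n]+\alpha_L(m')\otimes[m,n]$; (b) $\alpha_L(m)\otimes[n,n']-[n',m]\otimes\alpha_L(n)+[n,m]\otimes\alpha_L(n')$; (c) $[n,m]\otimes[m,n]$; (d) $[n,m]\otimes[m',n']+[n',m']\otimes[m,n]$; (e) $[[n,m],[n',m']]\otimes\alpha_L([m'',n''])+[[n',m'],[n'',m'']]\otimes\alpha_L([m,n])+[[n'',m''],[n,m]]\otimes\alpha_L([m',n'])$,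 for $m,m',m'',n,n',n''\in L$. The class of $m\otimes n$ is denoted $m\star n$; the product is $[m\star n,m'\star n']=-[n,m]\star[m',n']$ and $\alpha_{L\star L}(m\star n)=\alpha_L(m)\star\alpha_L(n)$. A central extension of $(L,\alpha_L)$ is a short exact sequence of Hom-Lie algebras $0\to(M,\alpha_M)\to(K,\alpha_K)\overset{\pi}{\to}(L,\alpha_L)\to0$ with $[M,K]=0$. It is universal central if for every central extension $0\to(M',\alpha_{M'})\to(K',\alpha_{K'})\overset{\pi'}{\to}(L,\alpha_L)\to0$ there exists one and only one homomorphism of Hom-Lie algebras $h:(K,\alpha_K)\to(K',\alpha_{K'})$ with $\pi'\circ h=\pi$.
   Formalization: In characteristic 2 every Hom-Lie algebra (L and all extensions) is also required to satisfy [x,x]=0; without this psi need not be well defined modulo relation (c), e.g. L=Ke, [e,e]=e, alpha=0, where L⋆L=0. *)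

(* Defs.v *)
From HB Require Import structures.
From mathcomp Require Import all_boot all_algebra.
From mathcomp Require Import boolp finmap monalg.

Set Implicit Arguments.
Unset Strict Implicit.
Unset Printing Implicit Defensive.

Import GRing.Theory.

Local Open Scope ring_scope.
Local Open Scope quotient_scope.

Section Span.
Variables (K : fieldType) (V : lmodType K).
Implicit Type S : V -> Prop.

Definition in_span S (x : V) : Prop :=
  exists (n : nat) (c : 'I_n -> K) (v : 'I_n -> V),
    (forall i, S (v i)) /\ x = \sum_i c i *: v i.

Definition span S : {pred V} := [pred x | `[< in_span S x >]].

Lemma mem_span S v : S v -> v \in span S.
Proof.
move=> Sv; apply/asboolP; exists 1%N, (fun=> 1), (fun=> v); split=> //.
by rewrite big_ord1 scale1r.
Qed.

Lemma span_submod S : submod_closed (span S).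
Proof.
split=> [|a x y /asboolP[n [c [v [Sv ->]]]] /asboolP[m [d [w [Sw ->]]]]].
  apply/asboolP; exists 0%N, (fun=> 0), (fun=> 0); split=> [[]//|].
  by rewrite big_ord0.
apply/asboolP; exists (n + m)%N.
exists (fun i => match split i with inl j => a * c j | inr j => d j end).
exists (fun i => match split i with inl j => v j | inr j => w j end).
split=> [i|]; first by case: (split i).
rewrite big_split_ord /= scaler_sumr; congr (_ + _); apply: eq_bigr => i _.
  by rewrite -[lshift m i]/(unsplit (inl i)) unsplitK scalerA.
by rewrite -[rshift n i]/(unsplit (inr i)) unsplitK.
Qed.

HB.instance Definition _ S := GRing.isSubmodClosed.Build K V (span S)
  (GRing.submod_closed_semi (span_submod S)).

Lemma span_min S (P : V -> Prop) : P 0 ->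
  (forall a x y, P x -> P y -> P (a *: x + y)) ->
  (forall v, S v -> P v) -> forall x, x \in span S -> P x.
Proof.
move=> P0 PD PS x /asboolP[n [c [v [Sv ->]]]].
elim/big_ind: _ => [//|y z Py Pz|i _].
  by rewrite -[y]scale1r; apply: PD.
by rewrite -[_ *: _]addr0; apply: PD => //; apply: PS.
Qed.

End Span.

Definition lquot (K : fieldType) (V : lmodType K) (S : V -> Prop) : Type :=
  Quotient.quot (span S : zmodClosed V).

HB.instance Definition _ (K : fieldType) (V : lmodType K) (S : V -> Prop) :=
  GRing.Zmodule.copy (lquot S) (Quotient.quot (span S : zmodClosed V)).

(* Locked: unfolding quotients makes failed unifications diverge. *)
HB.lock Definition lpi (K : fieldType) (V : lmodType K) (S : V -> Prop) (v : V)
  : lquot S := \pi_(Quotient.quot (span S : zmodClosed V)) v.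

HB.lock Definition lrepr (K : fieldType) (V : lmodType K) (S : V -> Prop)
  (x : lquot S) : V := repr (x : Quotient.quot (span S : zmodClosed V)).

(* The map induced on the quotient by f; meaningful when f vanishes on S. *)
HB.lock Definition lquot_lift (K : fieldType) (V : lmodType K) (S : V -> Prop)
  (W : lmodType K) (f : V -> W) (x : lquot S) : W := f (lrepr x).

Section QuotientSpace.
Variables (K : fieldType) (V : lmodType K) (S : V -> Prop).

Local Notation lquot := (lquot S).
Local Notation lpi := (@lpi K V S).

Lemma lpiD x y : lpi (x + y) = lpi x + lpi y.
Proof. by rewrite lpi.unlock; apply: (Quotient.pi_add (span S : zmodClosed V)). Qed.

Lemma lpiB x y : lpi (x - y) = lpi x - lpi y.
Proof.
rewrite lpiD; congr (_ + _).
by rewrite lpi.unlock; apply: (Quotient.pi_opp (span S : zmodClosed V)).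
Qed.

Lemma lpi_eq x y : (lpi x = lpi y) <-> (x - y \in span S).
Proof.
rewrite lpi.unlock; split=> [/eqP|h]; first by rewrite -Quotient.idealrBE.
by apply/eqP; rewrite -Quotient.idealrBE.
Qed.

Lemma lpi_repr x : lpi (lrepr x) = x.
Proof. by rewrite lpi.unlock lrepr.unlock; apply: reprK. Qed.

Definition lquot_scale (a : K) (x : lquot) : lquot := lpi (a *: lrepr x).

Lemma lpi_scale a v : lquot_scale a (lpi v) = lpi (a *: v).
Proof.
by apply/lpi_eq; rewrite -scalerBr rpredZ //; apply/lpi_eq; rewrite lpi_repr.
Qed.

Fact lquot_scaleA a b x :
  lquot_scale a (lquot_scale b x) = lquot_scale (a * b) x.
Proof. by rewrite -[x]lpi_repr !lpi_scale scalerA. Qed.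

Fact lquot_scale1 : left_id 1 lquot_scale.
Proof. by move=> x; rewrite -[x]lpi_repr lpi_scale scale1r. Qed.

Fact lquot_scaleDr : right_distributive lquot_scale +%R.
Proof.
move=> a x y.
by rewrite -[x]lpi_repr -[y]lpi_repr -lpiD !lpi_scale -lpiD scalerDr.
Qed.

Fact lquot_scaleDl x : {morph lquot_scale^~ x : a b / a + b}.
Proof. by move=> a b; rewrite -[x]lpi_repr !lpi_scale -lpiD scalerDl. Qed.

HB.instance Definition _ := GRing.Zmodule_isLmodule.Build K lquot
  lquot_scaleA lquot_scale1 lquot_scaleDr lquot_scaleDl.

Fact lpi_linear : linear lpi.
Proof. by move=> a x y; rewrite lpiD -lpi_scale. Qed.

HB.instance Definition _ := GRing.isLinear.Build K V lquot *:%R lpi lpi_linear.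

Lemma lpi_eq0 v : S v -> lpi v = 0.
Proof.
by move=> Sv; rewrite -(raddf0 lpi); apply/lpi_eq; rewrite subr0 mem_span.
Qed.

Section Lift.
Variables (W : lmodType K) (f : {linear V -> W}).
Hypothesis fS : forall v, S v -> f v = 0.

Lemma lquot_liftE v : lquot_lift f (lpi v) = f v.
Proof.
rewrite lquot_lift.unlock.
apply/eqP; rewrite -subr_eq0 -raddfB; apply/eqP.
apply: (span_min (P := fun x => f x = 0)) (raddf0 f) _ fS _ _.
  by move=> a x y fx fy; rewrite linearP fx fy scaler0 addr0.
by apply/lpi_eq; rewrite lpi_repr.
Qed.

Lemma lquot_lift_linear : linear (lquot_lift f).
Proof.
move=> a x y; rewrite -[x]lpi_repr -[y]lpi_repr -linearP !lquot_liftE.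
exact: linearP.
Qed.

End Lift.
End QuotientSpace.

(* {malg K[X]} is used only as the K-vector space with basis << x >>. *)
Definition free_lift (K : fieldType) (X : choiceType) (W : lmodType K)
  (f : X -> W) (g : {malg K[X]}) : W := \sum_(x <- msupp g) g@_x *: f x.

Section FreeLift.
Variables (K : fieldType) (X : choiceType) (W : lmodType K) (f : X -> W).

Lemma free_liftEw (d : {fset X}) (g : {malg K[X]}) :
  (msupp g `<=` d)%fset -> free_lift f g = \sum_(x <- d) g@_x *: f x.
Proof.
move=> le; rewrite /free_lift (big_fset_incl _ le) // => x _ xg.
by rewrite mcoeff_outdom // scale0r.
Qed.

Lemma free_lift_linear : linear (free_lift f).
Proof.
move=> a g h; pose d := (msupp g `|` msupp h)%fset.
rewrite !(@free_liftEw d) ?fsubsetUl ?fsubsetUr //; last first.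
  apply: fsubset_trans (msuppD_le _ _) _.
  by apply: fsetSU; apply: msuppZ_le.
rewrite scaler_sumr -big_split /=; apply: eq_bigr => x _.
by rewrite mcoeffD mcoeffZ scalerDl scalerA.
Qed.

HB.instance Definition _ :=
  GRing.isLinear.Build K {malg K[X]} W *:%R (free_lift f) free_lift_linear.

Lemma free_liftU x : free_lift f << x >> = f x.
Proof.
rewrite (@free_liftEw [fset x]%fset) ?msuppU_le // big_seq_fset1.
by rewrite mcoeffUU scale1r.
Qed.

End FreeLift.

Section TensorDef.
Variables (K : fieldType) (U V : lmodType K).

Local Notation e u v := (<< (u, v) >> : {malg K[(U * V)%type]}).

Inductive tensor_rel : {malg K[(U * V)%type]} -> Prop :=
| TensorL a u u' v :
    tensor_rel (e (a *: u + u') v - (a *: e u v + e u' v))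
| TensorR a u v v' :
    tensor_rel (e u (a *: v + v') - (a *: e u v + e u v')).

Definition tensor := lquot tensor_rel.
HB.instance Definition _ := GRing.Lmodule.on tensor.

End TensorDef.

HB.lock Definition tens (K : fieldType) (U V : lmodType K) (u : U) (v : V) :
  tensor U V := lpi (@tensor_rel K U V) << (u, v) >>.

Section Tensor.
Variables (K : fieldType) (U V : lmodType K).

Local Notation e u v := (<< (u, v) >> : {malg K[(U * V)%type]}).
Local Notation tensor := (tensor U V).
Local Notation tens := (@tens K U V).
Local Notation tensor_rel := (@tensor_rel K U V).

Lemma tens_bilinear : bilinear_for *:%R *:%R tens.
Proof.
have E x y z a : tensor_rel (x - (a *: y + z)) ->
    lpi tensor_rel x = a *: lpi tensor_rel y + lpi tensor_rel z.
  move/lpi_eq0; rewrite linearB linearD linearZ /= => /eqP.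
  by rewrite subr_eq0 => /eqP.
rewrite tens.unlock; split=> [v|u] a x y; first exact: E (TensorL a x y v).
exact: E (TensorR a u x y).
Qed.

Definition tens_lift (W : lmodType K) (f : U -> V -> W) : tensor -> W :=
  lquot_lift (free_lift (fun p => f p.1 p.2)).

Section Lift.
Variables (W : lmodType K) (f : U -> V -> W).
Hypothesis fB : bilinear_for *:%R *:%R f.

Let f_rel g : tensor_rel g -> free_lift (fun p => f p.1 p.2) g = 0.
Proof.
pose F := free_lift (fun p : U * V => f p.1 p.2) : {linear _ -> W}.
rewrite -/(F g); have FU u v : F (e u v) = f u v by exact: free_liftU.
case=> [a u u' v|a u v v']; rewrite linearB linearD linearZ !FU.
  by rewrite fB.1 subrr.
by rewrite fB.2 subrr.
Qed.

Lemma tens_liftE u v : tens_lift f (tens u v) = f u v.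
Proof. by rewrite tens.unlock /tens_lift (lquot_liftE f_rel); apply: free_liftU. Qed.

Lemma tens_lift_linear : linear (tens_lift f).
Proof. exact: (lquot_lift_linear f_rel). Qed.

End Lift.

Lemma tens_ind (P : tensor -> Prop) : P 0 ->
  (forall x y, P x -> P y -> P (x + y)) -> (forall u v, P (tens u v)) ->
  forall x, P x.
Proof.
move=> P0 PD Pt x; rewrite -[x]lpi_repr [lrepr x]monalgE.
apply: (big_ind (fun g => P (lpi tensor_rel g))) => [|g h Pg Ph|p _].
- by rewrite (raddf0 (lpi tensor_rel)).
- by rewrite lpiD; apply: PD.
set a := _@__; have -> : << a *g p >> = a *: e p.1 p.2.
  by apply/malgP=> q; rewrite mcoeffZ !mcoeffU -surjective_pairing mulr_natr.
have -> : lpi tensor_rel (a *: e p.1 p.2) = a *: tens p.1 p.2.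
  by rewrite tens.unlock; apply: (linearZ_LR (lpi tensor_rel)).
suff -> : a *: tens p.1 p.2 = tens (a *: p.1) p.2 by [].
by rewrite -[LHS]/(a *: tens^~ p.2 p.1) -(scalable_linear (tens_bilinear.1 p.2)).
Qed.

End Tensor.


(* In characteristic 2, antisymmetry does not give [x, x] = 0, and the map     *)
(* m (x) n |-> [m, n] need not vanish on the relations [StarRelC] below (take  *)
(* L = K e with [e, e] = e and alpha = 0).  The field [hlbr_char2] excludes    *)
(* this; it is vacuous in every other characteristic.                          *)
HB.mixin Record Lmodule_isHomLie (K : fieldType) L of GRing.Lmodule K L := {
  hlbr : L -> L -> L;
  hlalpha : L -> L;
  hlbr_bilinear : bilinear_for *:%R *:%R hlbr;
  hlalpha_linear : linear hlalpha;
  hlbrC : forall x y, hlbr x y = - hlbr y x;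
  hlbr_char2 : 2%N \in [pchar K] -> forall x, hlbr x x = 0;
  hl_jacobi : forall x y z,
    hlbr (hlalpha x) (hlbr y z) + hlbr (hlalpha z) (hlbr x y)
      + hlbr (hlalpha y) (hlbr z x) = 0;
  hlalphaB : forall x y, hlalpha (hlbr x y) = hlbr (hlalpha x) (hlalpha y)
}.

#[short(type="homLieType")]
HB.structure Definition HomLie (K : fieldType) :=
  {L of GRing.Lmodule K L & Lmodule_isHomLie K L}.

Notation "{[ x , y ]}" := (hlbr x y) (at level 0, format "{[ x ,  y ]}").

HB.instance Definition _ (K : fieldType) (L : homLieType K) :=
  bilinear_isBilinear.Build K L L L *:%R *:%R (@hlbr K L) hlbr_bilinear.
HB.instance Definition _ (K : fieldType) (L : homLieType K) :=
  GRing.isLinear.Build K L L *:%R (@hlalpha K L) hlalpha_linear.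

Section HomLieTheory.
Variables (K : fieldType) (L : homLieType K).
Implicit Types x y z : L.

Lemma hlbrPl a x y z : {[a *: x + y, z]} = a *: {[x, z]} + {[y, z]}.
Proof. exact: hlbr_bilinear.1. Qed.
Lemma hlbrPr a x y z : {[z, a *: x + y]} = a *: {[z, x]} + {[z, y]}.
Proof. exact: hlbr_bilinear.2. Qed.
Lemma hlbrNl x y : {[- x, y]} = - {[x, y]}.
Proof. exact: linearNl. Qed.
Lemma hlbrNr x y : {[x, - y]} = - {[x, y]}.
Proof. exact: linearNr. Qed.
Lemma hlbr0l x : {[0, x]} = 0. Proof. exact: linear0l. Qed.
Lemma hlbr0r x : {[x, 0]} = 0. Proof. exact: linear0r. Qed.
Lemma hlalpha0 : hlalpha (0 : L) = 0. Proof. exact: raddf0. Qed.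
Lemma hlalphaD x y : hlalpha (x + y) = hlalpha x + hlalpha y.
Proof. exact: raddfD. Qed.
Lemma hlalphaN x : hlalpha (- x) = - hlalpha x.
Proof. exact: raddfN. Qed.

Lemma hlbrxx x : {[x, x]} = 0.
Proof.
case: (boolP (2%N \in [pchar K])) => [/hlbr_char2-> //|].
rewrite inE /= => n2; have /eqP := hlbrC x x.
rewrite -subr_eq0 opprK -mulr2n -scaler_nat scaler_eq0.
by rewrite (negPf n2) => /eqP.
Qed.

End HomLieTheory.

HB.mixin Record isHomLieMorphism (K : fieldType) (L M : homLieType K)
    (f : L -> M) := {
  hlmorphB : forall x y, f {[x, y]} = {[f x, f y]};
  hlmorph_alpha : forall x, f (hlalpha x) = hlalpha (f x)
}.

#[short(type="homLieMorphism")]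
HB.structure Definition HomLieMorphism (K : fieldType) (L M : homLieType K) :=
  {f of @GRing.Linear K L M *:%R f & @isHomLieMorphism K L M f}.

Definition perfect (K : fieldType) (L : homLieType K) : Prop :=
  forall x : L, x \in span (fun z => exists a b : L, z = {[a, b]}).

Section StarDef.
Variables (K : fieldType) (L : homLieType K).
Implicit Types m n : L.

Local Notation "x (x) y" := (@tens K L L x y) (at level 40).
Local Notation al := (@hlalpha K L).

Inductive star_rel : tensor L L -> Prop :=
| StarRelA m m' n :
    star_rel ({[m, m']} (x) al n - al m (x) {[m', n]} + al m' (x) {[m, n]})
| StarRelB m n n' :
    star_rel (al m (x) {[n, n']} - {[n', m]} (x) al n + {[n, m]} (x) al n')
| StarRelC m n :
    star_rel ({[n, m]} (x) {[m, n]})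
| StarRelD m m' n n' :
    star_rel ({[n, m]} (x) {[m', n']} + {[n', m']} (x) {[m, n]})
| StarRelE m m' m'' n n' n'' :
    star_rel ({[{[n, m]}, {[n', m']}]} (x) al {[m'', n'']}
              + {[{[n', m']}, {[n'', m'']}]} (x) al {[m, n]}
              + {[{[n'', m'']}, {[n, m]}]} (x) al {[m', n']}).

Definition starsq := lquot star_rel.
HB.instance Definition _ := GRing.Lmodule.on starsq.

End StarDef.

HB.lock Definition star (K : fieldType) (L : homLieType K) (m n : L) :
  starsq L := lpi (@star_rel K L) (tens m n).

Section Star.
Variables (K : fieldType) (L : homLieType K).
Implicit Types m n : L.

Local Notation al := (@hlalpha K L).
Local Notation starsq := (starsq L).
Local Notation star := (@star K L).
Local Notation star_rel := (@star_rel K L).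

Fact star_bilinear : bilinear_for *:%R *:%R star.
Proof.
rewrite star.unlock; split=> [n|m] a x y.
  by rewrite (tens_bilinear _ _).1; apply: lpi_linear.
by rewrite (tens_bilinear _ _).2; apply: lpi_linear.
Qed.

HB.instance Definition _ :=
  bilinear_isBilinear.Build K L L starsq *:%R *:%R star star_bilinear.

Lemma star0l n : star 0 n = 0. Proof. exact: linear0l. Qed.
Lemma star0r m : star m 0 = 0. Proof. exact: linear0r. Qed.
Lemma starNl m n : star (- m) n = - star m n. Proof. exact: linearNl. Qed.
Lemma starNr m n : star m (- n) = - star m n. Proof. exact: linearNr. Qed.
Lemma starDl m m' n : star (m + m') n = star m n + star m' n.
Proof. exact: linearDl. Qed.
Lemma starDr m n n' : star m (n + n') = star m n + star m n'.
Proof. exact: linearDr. Qed.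

Lemma star_relA m m' n :
  star {[m, m']} (al n) - star (al m) {[m', n]} + star (al m') {[m, n]} = 0.
Proof. by rewrite star.unlock; have := lpi_eq0 (StarRelA m m' n); rewrite lpiD lpiB. Qed.

Lemma star_relB m n n' :
  star (al m) {[n, n']} - star {[n', m]} (al n) + star {[n, m]} (al n') = 0.
Proof. by rewrite star.unlock; have := lpi_eq0 (StarRelB m n n'); rewrite lpiD lpiB. Qed.

Lemma star_relC m n : star {[n, m]} {[m, n]} = 0.
Proof. by rewrite star.unlock; apply: lpi_eq0 (StarRelC m n). Qed.

Lemma star_relD m m' n n' :
  star {[n, m]} {[m', n']} + star {[n', m']} {[m, n]} = 0.
Proof. by rewrite star.unlock; have := lpi_eq0 (StarRelD m m' n n'); rewrite lpiD. Qed.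

Lemma star_relE m m' m'' n n' n'' :
  star {[{[n, m]}, {[n', m']}]} (al {[m'', n'']})
  + star {[{[n', m']}, {[n'', m'']}]} (al {[m, n]})
  + star {[{[n'', m'']}, {[n, m]}]} (al {[m', n']}) = 0.
Proof. by rewrite star.unlock; have := lpi_eq0 (StarRelE m m' m'' n n' n''); rewrite !lpiD. Qed.

Lemma star_ind (P : starsq -> Prop) : P 0 ->
  (forall x y, P x -> P y -> P (x + y)) -> (forall m n, P (star m n)) ->
  forall x, P x.
Proof.
rewrite star.unlock => P0 PD Pt x; rewrite -[x]lpi_repr.
elim/tens_ind: (lrepr x) => [|y z Py Pz|m n]; last exact: Pt.
  by rewrite (raddf0 (lpi star_rel)).
by rewrite lpiD; apply: PD.
Qed.

Definition star_lift (W : lmodType K) (f : L -> L -> W) : starsq -> W :=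
  lquot_lift (tens_lift f).

Definition star_compat (W : lmodType K) (f : L -> L -> W) : Prop :=
  [/\ forall m m' n,
        f {[m, m']} (al n) - f (al m) {[m', n]} + f (al m') {[m, n]} = 0,
      forall m n n',
        f (al m) {[n, n']} - f {[n', m]} (al n) + f {[n, m]} (al n') = 0,
      forall m n, f {[n, m]} {[m, n]} = 0,
      forall m m' n n', f {[n, m]} {[m', n']} + f {[n', m']} {[m, n]} = 0
    & forall m m' m'' n n' n'',
        f {[{[n, m]}, {[n', m']}]} (al {[m'', n'']})
        + f {[{[n', m']}, {[n'', m'']}]} (al {[m, n]})
        + f {[{[n'', m'']}, {[n, m]}]} (al {[m', n']}) = 0].

Section Lift.
Variables (W : lmodType K) (f : L -> L -> W).
Hypotheses (fB : bilinear_for *:%R *:%R f) (fR : star_compat f).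

HB.instance Definition _ := GRing.isLinear.Build K (tensor L L) W *:%R
  (tens_lift f) (tens_lift_linear fB).

Let f_rel t : star_rel t -> tens_lift f t = 0.
Proof.
pose F : {linear tensor L L -> W} := tens_lift f; rewrite -/(F t).
have FE u v : F (tens u v) = f u v by exact: (tens_liftE fB).
have FD u v : F (u + v) = F u + F v by exact: raddfD.
have FB u v : F (u - v) = F u - F v by exact: raddfB.
case: fR => fa fb fc fd fe [m m' n|m n n'|m n|m m' n n'|m m' m'' n n' n''].
- by rewrite FD FB !FE.
- by rewrite FD FB !FE.
- by rewrite FE.
- by rewrite FD !FE.
- by rewrite !FD !FE.
Qed.

Lemma star_liftE m n : star_lift f (star m n) = f m n.
Proof. rewrite star.unlock; exact: etrans (lquot_liftE f_rel _) (tens_liftE fB m n). Qed.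

Lemma star_lift_linear : linear (star_lift f).
Proof. exact: (lquot_lift_linear f_rel). Qed.

End Lift.

Lemma hlbr_compat : star_compat (@hlbr K L).
Proof.
split=> [m m' n|m n n'|m n|m m' n n'|m m' m'' n n' n''].
- have := hl_jacobi m m' n; rewrite (hlbrC {[m, m']}) (hlbrC m n) hlbrNr.
  by rewrite -!opprD (addrC {[al n, _]}) => ->; rewrite oppr0.
- have := hl_jacobi m n n'; rewrite (hlbrC {[n, m]}) (hlbrC {[n', m]}) opprK.
  by rewrite (hlbrC n m) hlbrNr opprK addrAC.
- by rewrite (hlbrC n m) hlbrNl hlbrxx oppr0.
- by rewrite (hlbrC {[n, m]}) (hlbrC n' m') (hlbrC n m) hlbrNr hlbrNl opprK subrr.
- have swap u m0 n0 : {[u, al {[m0, n0]}]} = {[al {[n0, m0]}, u]}.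
    by rewrite hlbrC (hlbrC m0) hlalphaN hlbrNl opprK.
  rewrite !swap -(hl_jacobi {[n, m]} {[n', m']} {[n'', m'']}).
  by rewrite [X in X + _ = _]addrC.
Qed.

Lemma hlbr_flip_bilinear : bilinear_for *:%R *:%R (fun m n => {[n, m]}).
Proof. by split=> u a x y; rewrite ?hlbrPl ?hlbrPr. Qed.

Lemma hlbr_flip_compat : star_compat (fun m n => {[n, m]}).
Proof.
have -> : (fun m n => {[n, m]}) = (fun m n => - {[m, n]}).
  by apply/funext=> m; apply/funext=> n; rewrite -hlbrC.
case: hlbr_compat => fa fb fc fd fe.
split=> *; rewrite -?opprD ?(fa, fb, fc, fd, fe) ?oppr0 //.
Qed.

Lemma star_alpha_bilinear :
  bilinear_for *:%R *:%R (fun m n => star (al m) (al n)).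
Proof. by split=> u a x y; rewrite linearP ?linearPl ?linearPr. Qed.

Lemma star_alpha_compat : star_compat (fun m n => star (al m) (al n)).
Proof.
split=> *; rewrite !hlalphaB.
- exact: star_relA.
- exact: star_relB.
- exact: star_relC.
- exact: star_relD.
- by rewrite -!(hlalphaB (al _)); apply: star_relE.
Qed.

Definition psi : starsq -> L := star_lift (@hlbr K L).

Lemma psiE m n : psi (star m n) = {[m, n]}.
Proof. exact: (star_liftE hlbr_bilinear hlbr_compat). Qed.

Fact psi_linear : linear psi.
Proof. exact: (star_lift_linear hlbr_bilinear hlbr_compat). Qed.

HB.instance Definition _ := GRing.isLinear.Build K starsq L *:%R psi psi_linear.

Lemma psi0 : psi 0 = 0. Proof. exact: raddf0. Qed.
Lemma psiD x y : psi (x + y) = psi x + psi y. Proof. exact: raddfD. Qed.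

Definition star_alpha : starsq -> starsq :=
  star_lift (fun m n => star (al m) (al n)).

Lemma star_alphaE m n : star_alpha (star m n) = star (al m) (al n).
Proof. exact: (star_liftE star_alpha_bilinear star_alpha_compat). Qed.

Fact star_alpha_linear : linear star_alpha.
Proof. exact: (star_lift_linear star_alpha_bilinear star_alpha_compat). Qed.

HB.instance Definition _ :=
  GRing.isLinear.Build K starsq starsq *:%R star_alpha star_alpha_linear.

Definition star_flip : starsq -> L := star_lift (fun m n => {[n, m]}).

Lemma star_flipE m n : star_flip (star m n) = {[n, m]}.
Proof. exact: (star_liftE hlbr_flip_bilinear hlbr_flip_compat). Qed.

Fact star_flip_linear : linear star_flip.
Proof. exact: (star_lift_linear hlbr_flip_bilinear hlbr_flip_compat). Qed.

HB.instance Definition _ :=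
  GRing.isLinear.Build K starsq L *:%R star_flip star_flip_linear.

(* Determined by its values on the [star m n], given by [star_brE].           *)
Definition star_br (x y : starsq) : starsq := - star (star_flip x) (psi y).

Lemma star_brE m n m' n' :
  star_br (star m n) (star m' n') = - star {[n, m]} {[m', n']}.
Proof. by rewrite /star_br star_flipE psiE. Qed.

Lemma star_br_psi (x y : starsq) : star_br x y = star (psi x) (psi y).
Proof.
rewrite /star_br -starNl; congr (star _ _).
elim/star_ind: x => [|x x' Hx Hx'|m n].
- by rewrite (raddf0 star_flip) psi0 oppr0.
- by rewrite (raddfD star_flip) psiD /= opprD Hx Hx'.
- by rewrite star_flipE psiE -hlbrC.
Qed.

Fact star_br_bilinear : bilinear_for *:%R *:%R star_br.
Proof.
by split=> u a x y; rewrite !star_br_psi linearP ?linearPl ?linearPr.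
Qed.

HB.instance Definition _ := bilinear_isBilinear.Build K starsq starsq starsq
  *:%R *:%R star_br star_br_bilinear.

Lemma star_br0l (x : starsq) : star_br 0 x = 0. Proof. exact: linear0l. Qed.
Lemma star_br0r x : star_br x 0 = 0. Proof. exact: linear0r. Qed.
Lemma star_brDl x y z : star_br (x + y) z = star_br x z + star_br y z.
Proof. exact: linearDl. Qed.
Lemma star_brDr x y z : star_br z (x + y) = star_br z x + star_br z y.
Proof. exact: linearDr. Qed.
Lemma star_alpha0 : star_alpha 0 = 0. Proof. exact: raddf0. Qed.
Lemma star_alphaD x y : star_alpha (x + y) = star_alpha x + star_alpha y.
Proof. exact: raddfD. Qed.

Fact star_brC (x y : starsq) : star_br x y = - star_br y x.
Proof.
elim/star_ind: x => [|x x' Hx Hx'|m n]; first by rewrite star_br0l star_br0r oppr0.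
  by rewrite star_brDl star_brDr Hx Hx' opprD.
elim/star_ind: y => [|y y' Hy Hy'|m' n']; first by rewrite star_br0l star_br0r oppr0.
  by rewrite star_brDl star_brDr Hy Hy' opprD.
apply/eqP; rewrite -subr_eq0 opprK !star_brE -opprD.
by rewrite star_relD oppr0.
Qed.

Fact star_brxx (x : starsq) : star_br x x = 0.
Proof.
elim/star_ind: x => [|x y Hx Hy|m n].
- exact: star_br0l.
- by rewrite star_brDl !star_brDr Hx Hy add0r addr0 (star_brC x) addNr.
- by rewrite star_brE star_relC oppr0.
Qed.

Lemma psi_star_alpha (x : starsq) : psi (star_alpha x) = al (psi x).
Proof.
elim/star_ind: x => [|x y Hx Hy|m n].
- by rewrite star_alpha0 psi0 hlalpha0.
- by rewrite star_alphaD !psiD hlalphaD Hx Hy.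
- by rewrite star_alphaE !psiE hlalphaB.
Qed.

Fact star_alphaB (x y : starsq) :
  star_alpha (star_br x y) = star_br (star_alpha x) (star_alpha y).
Proof.
by rewrite !star_br_psi star_alphaE !psi_star_alpha.
Qed.

Fact star_jacobi (x y z : starsq) :
  star_br (star_alpha x) (star_br y z) + star_br (star_alpha z) (star_br x y)
    + star_br (star_alpha y) (star_br z x) = 0.
Proof.
have D (a a' b b' c c' : starsq) :
    (a + a') + (b + b') + (c + c') = (a + b + c) + (a' + b' + c').
  by rewrite (addrACA a a') (addrACA (a + b)).
have Z := (star_br0l, star_br0r, star_alpha0, addr0).
have A := (star_brDl, star_brDr, star_alphaD).
elim/star_ind: x => [|x x' Hx Hx'|m n]; first by rewrite !Z.
  by rewrite !A D Hx Hx' addr0.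
elim/star_ind: y => [|y y' Hy Hy'|m' n']; first by rewrite !Z.
  by rewrite !A D Hy Hy' addr0.
elim/star_ind: z => [|z z' Hz Hz'|m'' n'']; first by rewrite !Z.
  by rewrite !A D Hz Hz' addr0.
rewrite !star_br_psi !star_alphaE !psiE -!hlalphaB.
have swap a b c d : star (al {[a, b]}) {[c, d]} = star {[c, d]} (al {[b, a]}).
  rewrite !hlalphaB [in RHS](hlbrC c) starNl; apply/eqP.
  by rewrite -addr_eq0 star_relD.
rewrite !swap -[RHS](star_relE n n' n'' m m' m''); congr (_ + _).
exact: addrC.
Qed.

HB.instance Definition _ := Lmodule_isHomLie.Build K starsq
  star_br_bilinear star_alpha_linear star_brC
  (fun _ => star_brxx) star_jacobi star_alphaB.

Fact psiB (x y : starsq) : psi {[x, y]} = {[psi x, psi y]}.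
Proof. by rewrite [{[x, y]}]star_br_psi psiE. Qed.

Fact psi_alpha (x : starsq) : psi (hlalpha x) = hlalpha (psi x).
Proof. exact: psi_star_alpha. Qed.

HB.instance Definition _ :=
  isHomLieMorphism.Build K starsq L psi psiB psi_alpha.

End Star.

Arguments psi {K} L _.

Section Kernel.
Variables (K : fieldType) (E L : homLieType K) (p : homLieMorphism E L).

Definition ker_pred : {pred E} := [pred x | p x == 0].

Fact ker_submod : submod_closed ker_pred.
Proof.
split=> [|a x y]; rewrite !inE ?raddf0 // => /eqP px /eqP py.
have -> : p (a *: x + y) = a *: p x + p y by exact: linearP.
by rewrite px py scaler0 addr0.
Qed.

HB.instance Definition _ := GRing.isSubmodClosed.Build K E ker_pred
  (GRing.submod_closed_semi ker_submod).

Record hlker := HLKer { hlker_val : E; hlkerP : hlker_val \in ker_pred }.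

HB.instance Definition _ := [isSub for hlker_val].
HB.instance Definition _ := [Choice of hlker by <:].
HB.instance Definition _ := [SubChoice_isSubLmodule of hlker by <:].

Lemma ker_eq0 (x : hlker) : p (val x) = 0.
Proof. by apply/eqP; have := hlkerP x. Qed.

Fact hlker_br_subproof (x y : hlker) : {[val x, val y]} \in ker_pred.
Proof. by rewrite inE hlmorphB ker_eq0 linear0l. Qed.

Fact hlker_alpha_subproof (x : hlker) : hlalpha (val x) \in ker_pred.
Proof. by rewrite inE hlmorph_alpha ker_eq0 raddf0. Qed.

Definition hlker_br (x y : hlker) : hlker := HLKer (hlker_br_subproof x y).
Definition hlker_alpha (x : hlker) : hlker := HLKer (hlker_alpha_subproof x).

Fact hlker_br_bilinear : bilinear_for *:%R *:%R hlker_br.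
Proof.
by split=> u a x y; apply: val_inj; rewrite /= ?linearPl ?linearPr.
Qed.

Fact hlker_alpha_linear : linear hlker_alpha.
Proof. by move=> a x y; apply: val_inj; rewrite /= linearP. Qed.

Fact hlker_brC x y : hlker_br x y = - hlker_br y x.
Proof. by apply: val_inj; rewrite raddfN /= -hlbrC. Qed.

Fact hlker_brxx x : hlker_br x x = 0.
Proof. by apply: val_inj; rewrite raddf0 /= hlbrxx. Qed.

Fact hlker_jacobi x y z :
  hlker_br (hlker_alpha x) (hlker_br y z)
  + hlker_br (hlker_alpha z) (hlker_br x y)
  + hlker_br (hlker_alpha y) (hlker_br z x) = 0.
Proof. by apply: val_inj; rewrite !raddfD raddf0 /= hl_jacobi. Qed.

Fact hlker_alphaB x y :
  hlker_alpha (hlker_br x y) = hlker_br (hlker_alpha x) (hlker_alpha y).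
Proof. by apply: val_inj; rewrite /= hlalphaB. Qed.

HB.instance Definition _ := Lmodule_isHomLie.Build K hlker
  hlker_br_bilinear hlker_alpha_linear hlker_brC (fun _ => hlker_brxx)
  hlker_jacobi hlker_alphaB.

Definition ker_incl (x : hlker) : E := hlker_val x.

Fact ker_incl_linear : linear ker_incl.
Proof. by move=> a x y; apply: (linearP (\val : hlker -> E)). Qed.

HB.instance Definition _ :=
  GRing.isLinear.Build K hlker E *:%R ker_incl ker_incl_linear.
HB.instance Definition _ := isHomLieMorphism.Build K hlker E ker_incl
  (fun _ _ => erefl) (fun _ => erefl).

End Kernel.

Arguments ker_incl {K E L} p _.

Section CentralExtension.
Variables (K : fieldType).

Record short_exact (M E L : homLieType K)
    (i : homLieMorphism M E) (p : homLieMorphism E L) : Prop := ShortExact {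
  short_exact_inj : injective i;
  short_exact_mid : forall x, p x = 0 <-> exists m, i m = x;
  short_exact_surj : forall y, exists x, p x = y
}.

Definition central_extension (M E L : homLieType K)
    (i : homLieMorphism M E) (p : homLieMorphism E L) : Prop :=
  short_exact i p /\ forall (m : M) (x : E), {[i m, x]} = 0.

Definition universal_central_extension (M E L : homLieType K)
    (i : homLieMorphism M E) (p : homLieMorphism E L) : Prop :=
  central_extension i p /\
  forall (M' E' : homLieType K)
    (i' : homLieMorphism M' E') (p' : homLieMorphism E' L),
  central_extension i' p' ->
  exists h : homLieMorphism E E', p' \o h =1 p /\
    forall h' : homLieMorphism E E', p' \o h' =1 p -> h' =1 h.

End CentralExtension.

(* Main.v *)
Require Import Defs.
From mathcomp Require Import all_boot all_algebra.
From HB Require Import structures.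
From mathcomp Require Import boolp.

(** Everything rests on two observations.

    In [starsq L] the bracket is [{[x, y]} = star (psi x) (psi y)]
    ([star_br_psi]).  Hence [ker psi] is central, and as soon as [psi] is onto,
    which is what perfectness provides ([psi_surj]), every generator [star m n]
    is itself a bracket.

    In a central extension [p : E -> L] the bracket of [E] factors through
    [p]: [{[a, b]}] depends only on [p a] and [p b] ([central_br_eq]).  It thus
    descends to a pairing [lifted_br : L -> L -> E] with
    [lifted_br (p a) (p b) = {[a, b]}].  Since [p] is onto, any identity that
    the bracket of [E] satisfies as a Hom-Lie algebra holds for this pairing;
    in particular the pairing is bilinear and respects the defining relations
    of [starsq L], because every Hom-Lie bracket does ([hlbr_compat]).  So it
    induces a map [starsq L -> E], which is the required morphism over [L].

    Uniqueness combines the two: a morphism over [L] sends [{[x, y]}] to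
    [{[h x, h y]}], which depends only on [p (h x) = psi x] and
    [p (h y) = psi y]; and brackets generate [starsq L] when [L] is perfect. *)

Set Implicit Arguments.
Unset Strict Implicit.
Unset Printing Implicit Defensive.

Import GRing.Theory.

Local Open Scope ring_scope.

(** * Lifting brackets along a central extension *)

Section LiftedBracket.
Variables (K : fieldType) (M E L : homLieType K).
Variables (i : homLieMorphism M E) (p : homLieMorphism E L).
Hypothesis pC : central_extension i p.

Lemma central_ker_br (z a : E) : p z = 0 -> {[z, a]} = 0.
Proof. by move=> /(short_exact_mid pC.1)[m <-]; apply: pC.2. Qed.

(** Moving either argument inside its fibre changes the bracket by a bracket
    with an element of the central kernel. *)
Lemma central_br_eq (a a' b b' : E) :
  p a = p a' -> p b = p b' -> {[a, b]} = {[a', b']}.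
Proof.
have brl (u u' v : E) : p u = p u' -> {[u, v]} = {[u', v]}.
  move=> eq_p; rewrite -[u](subrK u') -[u - u']scale1r hlbrPl central_ker_br.
    by rewrite scaler0 add0r.
  by rewrite raddfB /= eq_p subrr.
by move=> pa pb; rewrite (brl _ _ _ pa) hlbrC (brl _ _ _ pb) -hlbrC.
Qed.

Definition preimage (x : L) : E := projT1 (cid (short_exact_surj pC.1 x)).

Lemma preimageK x : p (preimage x) = x.
Proof. by rewrite /preimage; case: cid. Qed.

(** [preimage] is only a set-theoretic section of [p]; the pairing is still
    canonical, hence bilinear, because of [lifted_brE]. *)
Definition lifted_br (m n : L) : E := {[preimage m, preimage n]}.

Lemma lifted_brE a b : lifted_br (p a) (p b) = {[a, b]}.
Proof. by apply: central_br_eq; rewrite preimageK. Qed.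

Lemma p_lifted_br m n : p (lifted_br m n) = {[m, n]}.
Proof. by rewrite hlmorphB !preimageK. Qed.

Lemma lifted_br_alpha m n :
  lifted_br (hlalpha m) (hlalpha n) = hlalpha (lifted_br m n).
Proof.
rewrite -[m]preimageK -[n]preimageK -!hlmorph_alpha !lifted_brE.
by rewrite hlalphaB.
Qed.

Lemma lifted_br_bilinear : bilinear_for *:%R *:%R lifted_br.
Proof.
split=> u a x y; rewrite -[u]preimageK -[x]preimageK -[y]preimageK.
  by rewrite -linearP !lifted_brE hlbrPl.
by rewrite -linearP !lifted_brE hlbrPr.
Qed.

(** Once every element of [L] is written as an image under [p], each relation
    becomes the same relation for the bracket of [E]. *)
Lemma lifted_br_compat : star_compat lifted_br.
Proof.
have [ra rb rc rd re] := hlbr_compat E.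
split=> [m m' n|m n n'|m n|m m' n n'|m m' m'' n n' n''].
- rewrite -[m]preimageK -[m']preimageK -[n]preimageK.
  by rewrite -!(hlmorphB, hlmorph_alpha) !lifted_brE ra.
- rewrite -[m]preimageK -[n]preimageK -[n']preimageK.
  by rewrite -!(hlmorphB, hlmorph_alpha) !lifted_brE rb.
- rewrite -[m]preimageK -[n]preimageK.
  by rewrite -!hlmorphB !lifted_brE rc.
- rewrite -[m]preimageK -[m']preimageK -[n]preimageK -[n']preimageK.
  by rewrite -!hlmorphB !lifted_brE rd.
- rewrite -[m]preimageK -[m']preimageK -[m'']preimageK.
  rewrite -[n]preimageK -[n']preimageK -[n'']preimageK.
  by rewrite -!(hlmorphB, hlmorph_alpha) !lifted_brE re.
Qed.

Definition central_lift : starsq L -> E := star_lift lifted_br.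

Lemma central_liftE m n : central_lift (star m n) = lifted_br m n.
Proof. exact: (star_liftE lifted_br_bilinear lifted_br_compat). Qed.

HB.instance Definition _ :=
  GRing.isLinear.Build K (starsq L) E *:%R central_lift
    (star_lift_linear lifted_br_bilinear lifted_br_compat).

Lemma p_central_lift x : p (central_lift x) = psi L x.
Proof.
elim/star_ind: x => [|x y Hx Hy|m n].
- by rewrite !raddf0.
- by rewrite !raddfD /= Hx Hy.
- by rewrite central_liftE p_lifted_br psiE.
Qed.

Lemma central_liftB x y :
  central_lift {[x, y]} = {[central_lift x, central_lift y]}.
Proof.
rewrite [{[x, y]}]star_br_psi central_liftE.
by rewrite -!p_central_lift lifted_brE.
Qed.

Lemma central_lift_alpha x :
  central_lift (hlalpha x) = hlalpha (central_lift x).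
Proof.
elim/star_ind: x => [|x y Hx Hy|m n].
- by rewrite !raddf0.
- by rewrite !raddfD /= Hx Hy.
- by rewrite [hlalpha _]star_alphaE !central_liftE lifted_br_alpha.
Qed.

HB.instance Definition _ := isHomLieMorphism.Build K (starsq L) E central_lift
  central_liftB central_lift_alpha.

End LiftedBracket.

(** * The tensor square of a perfect Hom-Lie algebra *)

Section StarPerfect.
Variables (K : fieldType) (L : homLieType K).
Hypothesis Lperf : perfect L.

Lemma psi_surj (y : L) : exists x, psi L x = y.
Proof.
apply: (span_min (P := fun y => exists x, psi L x = y)) (Lperf y).
- by exists 0; rewrite raddf0.
- by move=> a _ _ [x <-] [x' <-]; exists (a *: x + x'); rewrite linearP.
- by move=> _ [a [b ->]]; exists (star a b); rewrite psiE.
Qed.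

Lemma star_is_br (m n : L) : exists x y : starsq L, star m n = {[x, y]}.
Proof.
have [[x <-] [y <-]] := (psi_surj m, psi_surj n).
by exists x, y; rewrite [RHS]star_br_psi.
Qed.

Lemma psi_central : central_extension (ker_incl (psi L)) (psi L).
Proof.
split; last first.
  by move=> k x; rewrite [LHS]star_br_psi ker_eq0 star0l.
split; [exact: val_inj | | exact: psi_surj] => x.
split=> [/eqP px|[k <-]]; last exact: ker_eq0.
by exists (HLKer (px : x \in ker_pred (psi L))).
Qed.

(** Two such morphisms agree on brackets, since a bracket of [E] only sees the
    images in [L]; and brackets generate [starsq L]. *)
Lemma hom_over_unique (M E : homLieType K) (i : homLieMorphism M E)
    (p : homLieMorphism E L) (h h' : homLieMorphism (starsq L) E) :
  central_extension i p -> p \o h =1 psi L -> p \o h' =1 psi L -> h =1 h'.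
Proof.
move=> pC hp h'p x; elim/star_ind: x => [|x y Hx Hy|m n].
- by rewrite !raddf0.
- by rewrite !raddfD /= Hx Hy.
- have [x [y ->]] := star_is_br m n.
  rewrite !hlmorphB; apply: (central_br_eq pC).
    exact: etrans (hp x) (esym (h'p x)).
  exact: etrans (hp y) (esym (h'p y)).
Qed.

End StarPerfect.

Theorem theorem3p4 (K : fieldType) (L : homLieType K) (Lperf : perfect L) :
  universal_central_extension (ker_incl (psi L)) (psi L).
Proof.
split=> [|M E i p pC]; first exact: psi_central.
exists (central_lift pC : homLieMorphism _ _).
have lift_over : p \o central_lift pC =1 psi L by exact: p_central_lift.
by split=> // h' h'p; apply: hom_over_unique Lperf _ _ _ _ _ _ pC h'p lift_over.
Qed.
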